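(* Let $T$ be a finite rooted tree with node set $\mathcal V$, cost function $c:\mathcal V\to\mathbb R_{\ge0}$, integer budget $B\ge1$, and importance function $r:\mathcal V\to\mathbb R_{>0}$. For every nonempty hypernode $\mathbf v$, the output of the SEI algorithm started at $\mathbf v$ satisfies \[\mathbb E\big[C_{\mathrm{SEI}}(T_{\mathbf v})\big]=\frac{\mathrm{Cost}(T_{\mathbf v})}{|\mathbf v|}.\]
   Context: For a node $v$, $S(v)$ is its set of children and $T_v$ is the subtree rooted at $v$, with $\mathrm{Cost}(T_v)=\sum_{u\in T_v}c(u)$. A hypernode is a set of distinct nodes of $T$ all at the same depth. For a set of nodes $\mathbf v$: $c(\mathbf v)=\sum_{v\in\mathbf v}c(v)$, $r(\mathbf v)=\sum_{v\in\mathbf v}r(v)$, $S(\mathbf v)=\bigcup_{v\in\mathbf v}S(v)$, $T_{\mathbf v}=\bigcup_{v\in\mathbf v}T_v$, and $\mathrm{Cost}(T_{\mathbf v})=\sum_{v\in\mathbf v}\mathrm{Cost}(T_v)$. The hyperchildren of $\mathbf v$ are $H(\mathbf v)=\{\mathbf w\subseteq S(\mathbf v): |\mathbf w|=\min(B,|S(\mathbf v)|)\}$. SEI algorithm started at $\mathbf v$: set $k=0$, $\mathbf x_0=\mathbf v$, $D=1$, $C=c(\mathbf x_0)/|\mathbf x_0|$. Repeat: if $S(\mathbf x_k)=\emptyset$, stop and output $C_{\mathrm{SEI}}(T_{\mathbf v})=C$. Otherwise choose $\mathbf x_{k+1}\in H(\mathbf x_k)$ by first choosing $x\in S(\mathbf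 x_k)$ with probability $r(x)/r(S(\mathbf x_k))$ and then choosing the remaining $\min(B,|S(\mathbf x_k)|)-1$ elements of $\mathbf x_{k+1}$ as a uniformly random subset of $S(\mathbf x_k)\setminus\{x\}$ (with fresh randomness at each step); set $D_k=\frac{|\mathbf x_{k+1}|}{|\mathbf x_k|}\cdot\frac{r(S(\mathbf x_k))}{r(\mathbf x_{k+1})}$, $D\leftarrow D\cdot D_k$, $C\leftarrow C+\frac{c(\mathbf x_{k+1})}{|\mathbf x_{k+1}|}D$, and $k\leftarrow k+1$. The estimate of $\mathrm{Cost}(T_{\mathbf v})$ is $|\mathbf v|C_{\mathrm{SEI}}(T_{\mathbf v})$. *)

(* Defs.v *)
From mathcomp Require Import all_boot all_order all_algebra.
From mathcomp Require Import reals.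

Set Implicit Arguments.
Unset Strict Implicit.
Unset Printing Implicit Defensive.

Import Order.TTheory GRing.Theory Num.Theory.
Local Open Scope ring_scope.

(* A tree is given by its parent map, with the root as its own parent by
   convention; reachability of the root then excludes any other cycle. *)
Structure rooted_tree := RootedTree {
  node :> finType;
  root : node;
  parent : node -> node;
  parent_root : parent root = root;
  root_reachable : forall v, fconnect parent v root
}.

Section Tree.
Variable T : rooted_tree.
Implicit Types (v : T) (x : {set T}).

Definition depth v : nat := findex (@parent T) v (root T).

(* The first conjunct is needed because [parent (root T) = root T]. *)
Definition children v : {set T} :=
  [set u | (u != root T) && (parent u == v)].

Definition subtree v : {set T} := [set u | fconnect (@parent T) u v].

Definition hypernode x : Prop := {in x &, forall u w, depth u = depth w}.

Definition hsucc x : {set T} := \bigcup_(v in x) children v.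

Definition hyperchildren (B : nat) x : {set {set T}} :=
  [set w : {set T} | (w \subset hsucc x) && (#|w| == minn B #|hsucc x|)].

Section Cost.
Variables (R : realFieldType) (c : T -> R).

Definition wsum x : R := \sum_(v in x) c v.

Definition cost v : R := \sum_(u in subtree v) c u.

Definition hcost x : R := \sum_(v in x) cost v.

End Cost.
End Tree.

(* A list of (probability, outcome) pairs; an outcome may occur several times,
   its probability being then the sum of the listed ones. *)
Record fdist (R : realFieldType) (A : Type) := FDist {
  outcomes :> seq (R * A);
  fdist_ge0 : all (fun p => 0 <= p.1) outcomes;
  fdist_sum1 : \sum_(p <- outcomes) p.1 == 1
}.

Section FDist.
Variable R : realFieldType.

Definition expect (mu : fdist R R) : R := \sum_(p <- mu) p.1 * p.2.

Fact ret_ge0 (A : Type) (a : A) : all (fun p : R * A => 0 <= p.1) [:: (1, a)].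
Proof. by rewrite /= ler01. Qed.

Fact ret_sum1 (A : Type) (a : A) : \sum_(p <- [:: (1 : R, a)]) p.1 == 1.
Proof. by rewrite big_seq1. Qed.

Definition ret (A : Type) (a : A) : fdist R A := FDist (ret_ge0 a) (ret_sum1 a).

Section Bind.
Variables (A A' : Type) (mu : fdist R A) (f : A -> fdist R A').

Definition bind_outcomes : seq (R * A') :=
  [seq (p.1 * q.1, q.2) | p <- outcomes mu, q <- outcomes (f p.2)].

Fact bind_ge0 : all (fun p => 0 <= p.1) bind_outcomes.
Proof.
rewrite /bind_outcomes; elim: (outcomes mu) (fdist_ge0 mu) => //= p s IH.
case/andP => p0 /IH s0; rewrite all_cat s0 andbT all_map.
by apply: sub_all (fdist_ge0 (f p.2)) => q /= q0; rewrite mulr_ge0.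
Qed.

Fact bind_sum1 : \sum_(p <- bind_outcomes) p.1 == 1.
Proof.
apply/eqP; rewrite big_allpairs_dep -[RHS](eqP (fdist_sum1 mu)).
apply: eq_bigr => p _ /=.
by rewrite -mulr_sumr (eqP (fdist_sum1 (f p.2))) mulr1.
Qed.

(* Draw [a] from [mu], then an outcome from [f a] with fresh randomness. *)
Definition bind : fdist R A' := FDist bind_ge0 bind_sum1.

End Bind.

Section Weighted.
Variables (I : finType) (x0 : I) (w : I -> R) (A : {set I}).

Definition weighted_outcomes : seq (R * I) :=
  if [forall x in A, 0 <= w x] && (0 < \sum_(x in A) w x)
  then [seq (w x / \sum_(y in A) w y, x) | x <- enum A]
  else [:: (1, x0)].

Fact weighted_ge0 : all (fun p => 0 <= p.1) weighted_outcomes.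
Proof.
rewrite /weighted_outcomes; case: ifP => [/andP[/forall_inP w0 wA]|_]; last first.
  exact: ret_ge0.
rewrite all_map; apply/allP => x /=; rewrite mem_enum => xA.
by rewrite divr_ge0 ?w0 // ltW.
Qed.

Fact weighted_sum1 : \sum_(p <- weighted_outcomes) p.1 == 1.
Proof.
rewrite /weighted_outcomes; case: ifP => [/andP[_ wA]|_]; last exact: ret_sum1.
by rewrite big_map /= -mulr_suml big_enum /= divff // gt_eqF.
Qed.

(* Outcome [x] in [A] with probability proportional to [w x]. The default
   value [x0] is returned only when the weights cannot be normalized. *)
Definition weighted : fdist R I := FDist weighted_ge0 weighted_sum1.

End Weighted.

Definition uniform (I : finType) (x0 : I) (A : {set I}) : fdist R I :=
  weighted x0 (fun=> 1) A.

End FDist.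

Section SEI.
Variables (R : realFieldType) (T : rooted_tree) (c r : T -> R) (B : nat).
Implicit Types x : {set T}.

Definition sei_step x : fdist R {set T} :=
  bind (weighted (root T) r (hsucc x)) (fun y =>
  bind (uniform R set0
          [set w : {set T} | (w \subset hsucc x :\ y) &&
                             (#|w| == (minn B #|hsucc x|).-1)]) (fun w =>
  ret R (y |: w))).

Fixpoint sei_loop (n : nat) x (D C : R) : fdist R R :=
  if n isn't n'.+1 then ret R C else
  if hsucc x == set0 then ret R C else
  bind (sei_step x) (fun x' =>
    let Dk := #|x'|%:R / #|x|%:R * (wsum r (hsucc x) / wsum r x') in
    let D' := D * Dk in
    let C' := C + wsum c x' / #|x'|%:R * D' in
    sei_loop n' x' D' C').

(* Each iteration moves one level down the tree, so the bound [#|T|] on the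
   number of iterations is never reached: see [sei_unfold]. *)
Definition sei x (D C : R) : fdist R R := sei_loop #|T| x D C.

Definition C_SEI (v : {set T}) : fdist R R := sei v 1 (wsum c v / #|v|%:R).

End SEI.

Section Check.
Variables (R : realFieldType) (T : rooted_tree) (c r : T -> R) (B : nat).
Implicit Types x : {set T}.

Lemma fdist_eq (A : Type) (mu nu : fdist R A) :
  outcomes mu = outcomes nu -> mu = nu.
Proof.
case: mu nu => [s s0 s1] [t t0 t1] /= st; case: t / st t0 t1 => t0 t1.
by rewrite (bool_irrelevance s0 t0) (bool_irrelevance s1 t1).
Qed.

Lemma eq_in_bind (A : eqType) (A' : Type) (mu : fdist R A)
    (f g : A -> fdist R A') :
  (forall p, p \in outcomes mu -> f p.2 = g p.2) -> bind mu f = bind mu g.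
Proof.
move=> fg; apply: fdist_eq; rewrite /= /bind_outcomes.
by congr flatten; apply/eq_in_map => p /fg ->.
Qed.

Lemma mem_bind (A A' : eqType) (mu : fdist R A) (f : A -> fdist R A') q :
  q \in outcomes (bind mu f) ->
  exists p1 p2, [/\ p1 \in outcomes mu, p2 \in outcomes (f p1.2) & q.2 = p2.2].
Proof.
by case/allpairsPdep => p1 [p2 [h1 h2 ->]]; exists p1, p2.
Qed.

Lemma mem_weighted (I : finType) (x0 : I) (w : I -> R) (A : {set I}) p :
  (forall i, 0 < w i) -> A != set0 -> p \in outcomes (weighted x0 w A) ->
  p.2 \in A.
Proof.
move=> w0 /set0Pn[i iA] /=; rewrite /weighted_outcomes ifT.
  by case/mapP => j; rewrite mem_enum => jA ->.
apply/andP; split; first by apply/forall_inP => j _; exact: ltW.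
by rewrite (bigD1 i) //= ltr_pwDl // sumr_ge0 // => j _; exact: ltW.
Qed.

Lemma sei_step_hyperchildren x p : (forall u, 0 < r u) -> (0 < B)%N ->
  hsucc x != set0 -> p \in outcomes (sei_step r B x) ->
  p.2 \in hyperchildren B x.
Proof.
move=> r0 B0 x0 /mem_bind[[a y] [q [/= yS]]].
have {}yS : y \in hsucc x by apply: (mem_weighted r0 x0 yS).
move=> /mem_bind[[b w] [[d z] [/= wS]]]; rewrite inE => /eqP[_ ->] -> ->.
have Spos : (0 < #|hsucc x|)%N by rewrite card_gt0.
have mpos : (0 < minn B #|hsucc x|)%N by rewrite leq_min B0.
have Sy : #|hsucc x :\ y| = #|hsucc x|.-1 by rewrite (cardsD1 y (hsucc x)) yS.
have : w \in [set w : {set T} | (w \subset hsucc x :\ y) &&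
                 (#|w| == (minn B #|hsucc x|).-1)].
  apply: (mem_weighted _ _ wS) => [i|]; first exact: ltr01.
  have : (0 < 'C(#|hsucc x :\ y|, (minn B #|hsucc x|).-1))%N.
    rewrite bin_gt0 Sy -ltnS !prednK //; exact: geq_minr.
  by rewrite -cards_draws card_gt0.
rewrite !inE => /andP[wsub /eqP wc]; apply/andP; split.
  by rewrite subUset sub1set yS (subset_trans wsub) // subsetDl.
have yw : y \notin w.
  by apply/negP => /(subsetP wsub); rewrite !inE eqxx.
by rewrite cardsU1 yw wc add1n prednK.
Qed.

Lemma depth_lt (u : T) : (depth u < #|T|)%N.
Proof. by rewrite (leq_trans (findex_max (root_reachable u))) ?max_card. Qed.

Lemma depth_children (u v : T) : u \in children v -> depth u = (depth v).+1.
Proof.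
rewrite inE eq_sym => /andP[u0 /eqP <-].
exact: fconnect_findex (root_reachable u) u0.
Qed.

Lemma hsucc_nil x n : {in x, forall u, #|T| <= depth u + n}%N -> n = 0%N ->
  hsucc x = set0.
Proof.
move=> xn n0; apply/setP => u; rewrite inE; apply/negP => /bigcupP[w /xn].
by rewrite n0 addn0 leqNgt depth_lt.
Qed.

Lemma sei_loopS n x D C : (forall u, 0 < r u) -> (0 < B)%N ->
  {in x, forall u, #|T| <= depth u + n}%N ->
  sei_loop c r B n.+1 x D C = sei_loop c r B n x D C.
Proof.
move=> r0 B0; elim: n x D C => [|n IH] x D C xn.
  by rewrite /= (hsucc_nil xn) ?eqxx.
rewrite [LHS]/= [RHS]/=; case: ifPn => // x0.
apply: eq_in_bind => p /(sei_step_hyperchildren r0 B0 x0).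
rewrite inE => /andP[/subsetP px _]; apply: (IH p.2) => u /px.
case/bigcupP => v /xn vn /depth_children ->.
by rewrite addSnnS.
Qed.

Lemma sei_unfold x D C : (forall u, 0 < r u) -> (0 < B)%N ->
  sei c r B x D C =
  if hsucc x == set0 then ret R C else
  bind (sei_step r B x) (fun x' =>
    let Dk := #|x'|%:R / #|x|%:R * (wsum r (hsucc x) / wsum r x') in
    let D' := D * Dk in
    let C' := C + wsum c x' / #|x'|%:R * D' in
    sei c r B x' D' C').
Proof.
move=> r0 B0; rewrite /sei -sei_loopS // => u _.
exact: leq_addl.
Qed.

End Check.

(* Main.v *)
(** If [X'] is the random successor of [x] and [S = hsucc x], [m = #|X'|], then
    [X' = W] has probability proportional to [wsum r W], since each [y] in [W]
    may have been drawn first. The factor [D_k] cancels this bias: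
    the mean of [hcost X' / wsum r X'] is [hcost S / wsum r S], as each node of
    [S] lies in the same number ['C(#|S| - 1, m - 1)] of hyperchildren. With
    [hcost x = wsum c x + hcost S], induction along the levels of the tree shows
    that the loop entered at [x] with accumulators [D], [C] has mean
    [C + D * hcost S / #|x|]. *)
Require Import Defs.
From mathcomp Require Import all_boot all_order all_algebra.
From mathcomp Require Import reals.
From mathcomp Require Import ring.

Import Order.TTheory GRing.Theory Num.Theory.
Local Open Scope ring_scope.

(** * Recursion of the subtree cost along the levels of the tree *)

Section TreeCost.
Variable T : rooted_tree.
Implicit Types (u v w : T) (x : {set T}).

Lemma depth_parent_le u : (depth (parent u) <= depth u)%N.
Proof.
have [->|u0] := eqVneq u (Defs.root T); first by rewrite parent_root.
have /depth_children -> : u \in children (parent u) by rewrite inE u0 eqxx.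
exact: leqnSn.
Qed.

Lemma depth_subtree u v : u \in subtree v -> (depth v <= depth u)%N.
Proof.
rewrite inE => /iter_findex <-; elim: (findex _ u v) => //= n.
exact: leq_trans (depth_parent_le _).
Qed.

Lemma mem_subtree u v :
  (u \in subtree v) =
  (u == v) || (u != Defs.root T) && (parent u \in subtree v).
Proof.
have [->|uv] := eqVneq u v; first by rewrite inE connect0.
rewrite !inE; apply/idP/idP => [uv_conn|/andP[_ puv]]; last first.
  exact: connect_trans (fconnect1 _ u) puv.
move/iter_findex: uv_conn.
case: (findex _ u v) => [/= /eqP|n]; rewrite ?(negPf uv) //.
rewrite iterSr => puv; apply/andP; split; last by rewrite -puv fconnect_iter.
(* The root is a fixed point of [parent], so from [u = root T] the iteration could only end at
   [v = u]. *)
apply: contraNneq uv => u0; rewrite -puv u0 parent_root.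
by apply/eqP; elim: n {puv} => //= n <-; rewrite parent_root.
Qed.

(** The two cases of [mem_subtree] exclude each other by depth, so the disjunction becomes a sum,
    ready to be added up over children. *)
Lemma mem_subtree_nat u v :
  (u \in subtree v) =
  ((u == v) + (u != Defs.root T) * (parent u \in subtree v))%N :> nat.
Proof.
rewrite mem_subtree; have [<-{v}|_] := eqVneq u v; last first.
  by case: (u != _); rewrite ?mul1n ?mul0n.
case: (boolP (u != Defs.root T)) => //= u0.
have /depth_children du : u \in children (parent u) by rewrite inE u0 eqxx.
by case: (boolP (_ \in _)) => // /depth_subtree; rewrite du ltnn.
Qed.

(** Induction on the depth of [u]: unfolding each membership at [u] passes to [parent u], and the
    terms [u == w] add up to [u \in children v], which is the term [parent u == v] of the induction
    hypothesis. *)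
Lemma mem_subtree_children u v :
  (u \in subtree v) =
  ((u == v) + \sum_(w in children v) (u \in subtree w))%N :> nat.
Proof.
have [n] := ubnP (depth u); elim: n u => // n IH u un.
rewrite (mem_subtree_nat u v); congr addn.
under eq_bigr do rewrite mem_subtree_nat.
rewrite big_split -big_distrr /=.
have -> : (\sum_(w in children v) (u == w) = (u \in children v))%N.
  case: (boolP (u \in children v)) => uv.
    rewrite (bigD1 u) //= eqxx big1 // => w /andP[_ wu].
    by rewrite eq_sym (negPf wu).
  by rewrite big1 // => w wv; case: eqP wv uv => // -> ->.
have [->|u0] := eqVneq u (Defs.root T).
  by rewrite [_ \in children _]inE eqxx !mul0n.
rewrite [_ \in children _]inE u0 /= !mul1n IH //.
have /depth_children du : u \in children (parent u) by rewrite inE u0 eqxx.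
by rewrite -du.
Qed.

Lemma cards_hsucc_gt0 x : hsucc x != set0 -> (0 < #|x|)%N.
Proof.
by rewrite card_gt0; apply: contraNneq => ->; rewrite /hsucc big_set0.
Qed.

Variables (R : realFieldType) (c : T -> R).

Lemma cost_children v : cost c v = c v + \sum_(w in children v) cost c w.
Proof.
have costE w : cost c w = \sum_u c u *+ (u \in subtree w).
  by rewrite /cost big_mkcond; apply: eq_bigr => u _; case: (_ \in _).
rewrite costE; under [X in _ + X]eq_bigr do rewrite costE.
rewrite exchange_big /= (eq_bigr (fun u => c u *+ (u == v) +
  \sum_(w in children v) c u *+ (u \in subtree w))); last first.
  by move=> u _; rewrite mem_subtree_children mulrnDr sumrMnr.
rewrite big_split /=; congr (_ + _).
by rewrite (bigD1 v) //= eqxx big1 ?addr0 // => u /negPf ->.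
Qed.

(** A node has only one parent, so the sets of children of distinct nodes are disjoint and [hsucc x]
    is partitioned by [parent]. *)
Lemma hcost_hsucc x : hcost c x = wsum c x + hcost c (hsucc x).
Proof.
rewrite /hcost; under eq_bigr do rewrite cost_children.
rewrite big_split; congr (_ + _) => /=.
rewrite [RHS](partition_big (@parent T) (fun v => v \in x)) => [|u]; last first.
  by case/bigcupP => v vx; rewrite inE => /andP[_ /eqP ->].
apply: eq_bigr => v vx; apply: eq_bigl => u.
apply/idP/andP => [uv|[/bigcupP[w _ +]]].
  split; first by apply/bigcupP; exists v.
  by move: uv; rewrite inE => /andP[].
by rewrite !inE => /andP[-> _] ->.
Qed.

End TreeCost.

(** * Means under the sampling primitives *)

Section Mean.
Variable R : realFieldType.

Lemma sum_bind (A A' : Type) (mu : fdist R A) (f : A -> fdist R A')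
    (g : A' -> R) :
  \sum_(p <- bind mu f) p.1 * g p.2 =
  \sum_(p <- mu) p.1 * \sum_(q <- f p.2) q.1 * g q.2.
Proof.
rewrite big_allpairs_dep; apply: eq_bigr => p _.
by rewrite mulr_sumr; apply: eq_bigr => q _; rewrite mulrA.
Qed.

Lemma sum_ret (A : Type) (a : A) (g : A -> R) :
  \sum_(p <- ret R a) p.1 * g p.2 = g a.
Proof. by rewrite big_seq1 mul1r. Qed.

Lemma sum_weighted (I : finType) (x0 : I) (w : I -> R) (A : {set I})
    (g : I -> R) : (forall i, 0 < w i) -> A != set0 ->
  \sum_(p <- weighted x0 w A) p.1 * g p.2 =
  (\sum_(i in A) w i * g i) / \sum_(i in A) w i.
Proof.
move=> w0 /set0Pn[i iA] /=; rewrite /weighted_outcomes ifT.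
  rewrite big_map big_enum mulr_suml.
  by apply: eq_bigr => j _; rewrite mulrAC.
apply/andP; split; first by apply/forall_inP => j _; exact: ltW.
by rewrite (bigD1 i) //= ltr_pwDl // sumr_ge0 // => j _; exact: ltW.
Qed.

Lemma sum_uniform (I : finType) (x0 : I) (A : {set I}) (g : I -> R) :
  A != set0 ->
  \sum_(p <- uniform R x0 A) p.1 * g p.2 = (\sum_(i in A) g i) / #|A|%:R.
Proof.
move=> A0; rewrite sum_weighted // sumr_const.
by congr (_ / _); apply: eq_bigr => i _; rewrite mul1r.
Qed.

(** Double counting: the pairs [(y, w)] correspond to the pairs [(W, y)] with [y] in [W], through
    [W = y |: w] and [w = W :\ y]. *)
Lemma sum_draws (I : finType) (S : {set I}) (k : nat)
    (G : I -> {set I} -> R) :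
  \sum_(y in S) \sum_(w in [set w : {set I} | (w \subset S :\ y) &&
                                              (#|w| == k)]) G y (y |: w) =
  \sum_(W in [set W : {set I} | (W \subset S) && (#|W| == k.+1)])
    \sum_(y in W) G y W.
Proof.
rewrite [RHS](exchange_big_dep (mem S)) /=; last first.
  by move=> W y; rewrite inE => /andP[/subsetP WS _] /WS.
apply: eq_bigr => y yS.
rewrite [RHS](reindex_onto (fun w => y |: w) (fun W => W :\ y)) /=; last first.
  by move=> W /andP[_ yW]; rewrite setD1K.
apply: eq_bigl => w; rewrite !inE eqxx andbT subUset sub1set yS /= subsetD1.
(* If [y] is in [w], removing [y] from [y |: w] does not give back [w], so both conditions fail. *)
rewrite cardsU1; have [yw|yw] := boolP (y \in w).
  rewrite andbF /=; apply/esym/negbTE/nandP; right.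
  by apply: contraTneq yw => <-; rewrite !inE eqxx.
by rewrite andbT add1n eqSS setU1K // eqxx andbT.
Qed.

End Mean.

(** * Unbiasedness of one step, then of the loop *)

Section Loop.
Variables (R : realFieldType) (T : rooted_tree) (c r : T -> R) (B : nat).
Hypotheses (r_gt0 : forall u, 0 < r u) (B_gt0 : (0 < B)%N).
Implicit Types x : {set T}.

Lemma wsum_gt0 x : x != set0 -> 0 < wsum r x.
Proof.
case/set0Pn => u ux; rewrite /wsum (bigD1 u) //= ltr_pwDl // sumr_ge0 // => j _.
exact: ltW.
Qed.

Lemma sum_sei_step x (g : T -> R) : hsucc x != set0 ->
  \sum_(p <- sei_step r B x) p.1 * (wsum g p.2 / wsum r p.2) =
  wsum g (hsucc x) / wsum r (hsucc x).
Proof.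
move=> x0; set S := hsucc x.
have S_gt0 : (0 < #|S|)%N by rewrite card_gt0.
have [k Ek] : {k | minn B #|S| = k.+1}.
  by exists (minn B #|S|).-1; rewrite prednK // leq_min B_gt0.
pose draws y := [set w : {set T} | (w \subset S :\ y) && (#|w| == k)].
have card_draws y : y \in S -> #|draws y| = 'C(#|S|.-1, k).
  by move=> yS; rewrite cards_draws (cardsD1 y S) yS.
have N_gt0 : (0 < 'C(#|S|.-1, k))%N.
  by rewrite bin_gt0 -ltnS prednK // -Ek geq_minr.
pose h W := wsum g W / wsum r W.
pose f y := bind (uniform R set0 (draws y)) (fun w => ret R (y |: w)).
have mean_f y : y \in S ->
    \sum_(q <- f y) q.1 * h q.2 =
    (\sum_(w in draws y) h (y |: w)) / 'C(#|S|.-1, k)%:R.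
  move=> yS; rewrite -(card_draws y yS) sum_bind.
  rewrite -(sum_uniform _ _ set0 _ (fun w => h (y |: w))).
    by apply: eq_bigr => p _; rewrite sum_ret.
  by rewrite -card_gt0 card_draws.
rewrite /sei_step -/S Ek (sum_bind _ _ _ _ f h).
rewrite (sum_weighted _ _ _ _ _ (fun y => \sum_(q <- f y) q.1 * h q.2)) //.
congr (_ / _); under eq_bigr => y yS do rewrite (mean_f y yS) mulrA mulr_sumr.
rewrite -mulr_suml (sum_draws _ _ _ _ (fun y W => r y * h W)).
(* The weights [r y] of the possible first draws add up to [wsum r W], the denominator of [h W]. *)
rewrite (eq_bigr (fun W : {set T} => \sum_(y in W) g y)) => [|W]; last first.
  rewrite inE => /andP[_ /eqP cW]; rewrite -mulr_suml mulrC divfK //.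
  by rewrite gt_eqF // wsum_gt0 // -card_gt0 cW.
(* Read backwards with a summand independent of [W], the double count repeats [g y] once per element
   of [draws y], which cancels the binomial. *)
rewrite -(sum_draws _ _ _ _ (fun y _ => g y)) mulr_suml.
apply: eq_bigr => y yS.
rewrite sumr_const card_draws // -[g y *+ _]mulr_natr mulfK //.
by rewrite pnatr_eq0 -lt0n.
Qed.

Lemma sei_loop_mean n x D C : {in x, forall u, #|T| <= depth u + n}%N ->
  expect (sei_loop c r B n x D C) = C + D * (hcost c (hsucc x) / #|x|%:R).
Proof.
(* Covers both exits of the loop: at [n = 0] the depth bound on [x] already forces [hsucc x] to be
   empty. *)
have leaf y D' C' : hsucc y = set0 ->
    expect (ret R C') = C' + D' * (hcost c (hsucc y) / #|y|%:R).
  move=> ->; rewrite /expect (sum_ret _ _ _ id).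
  by rewrite /hcost big_set0 mul0r mulr0 addr0.
elim: n x D C => [|n IH] x D C xn; first exact/leaf/(hsucc_nil xn).
rewrite /=; case: ifPn => [/eqP|x0]; first exact: leaf.
rewrite /expect (sum_bind _ _ _ _ _ id).
(* The new cost term and the mean of the remaining loop merge into [hcost c p.2] by [hcost_hsucc];
   the factor [#|p.2|] of [Dk] cancels their common denominator. *)
rewrite (eq_big_seq (fun p => p.1 * C + D / #|x|%:R * wsum r (hsucc x) *
    (p.1 * (hcost c p.2 / wsum r p.2)))); last first.
  move=> p /(sei_step_hyperchildren r_gt0 B_gt0 x0).
  rewrite inE => /andP[/subsetP px /eqP cp].
  rewrite [\sum_(_ <- _) _]IH; last first.
    move=> u /px /bigcupP[v /xn vn /depth_children ->].
    by rewrite addSnnS.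
  have p_neq0 : #|p.2|%:R != 0 :> R.
    by rewrite pnatr_eq0 -lt0n cp leq_min B_gt0 card_gt0.
  set E := D * _; rewrite -addrA [_ / _ * E]mulrC -mulrDr -mulrDl -hcost_hsucc.
  have r_neq0 : wsum r p.2 != 0.
    by rewrite gt_eqF // wsum_gt0 // -card_gt0 lt0n -(pnatr_eq0 R).
  have x_neq0 : #|x|%:R != 0 :> R by rewrite pnatr_eq0 -lt0n cards_hsucc_gt0.
  by rewrite /E; field; rewrite p_neq0 x_neq0 r_neq0.
rewrite big_split -mulr_suml -mulr_sumr (eqP (fdist_sum1 _)) mul1r.
rewrite (sum_sei_step _ (cost c)) // -[hcost c _]/(wsum (cost c) _) /=.
congr (_ + _); field.
by rewrite pnatr_eq0 -lt0n cards_hsucc_gt0 // gt_eqF ?wsum_gt0.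
Qed.

End Loop.

Theorem theorem3 (R : realType) (T : rooted_tree) (c r : T -> R) (B : nat)
    (c_ge0 : forall u : T, 0 <= c u) (r_gt0 : forall u : T, 0 < r u)
    (B_gt0 : (1 <= B)%N) (v : {set T}) (v_hyper : hypernode v)
    (v_neq0 : v != set0) :
  expect (C_SEI c r B v) = hcost c v / #|v|%:R.
Proof.
rewrite /C_SEI /sei sei_loop_mean // => [|u _]; last exact: leq_addl.
by rewrite mul1r (hcost_hsucc _ _ _ v) mulrDl.
Qed.
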